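(* Let $\mathbb F$ be a field of characteristic $0$, let $r\in\mathcal R_{\mathbb F}(\underline z)$ be a noncommutative rational expression and assume $\operatorname{dom}_mr\ne\emptyset$. Then $r$ is a rational identity if and only if $r$ vanishes on $\operatorname{dom}_Nr$, where $$N=m\left\lceil\tfrac m2\,\varkappa(r)\right\rceil.$$
   Context: $\mathcal R_{\mathbb F}(\underline z)$ is the set of syntactically valid combinations of noncommutative polynomials over $\mathbb F$ in $\underline z=\{z_1,\dots,z_g\}$, operations $+,\cdot,{}^{-1}$ and parentheses. For $\underline a\in M_m(\mathbb F)^g$, $r(\underline a)$ is obtained by replacing $z_j$ by $a_j$ and $1$ by $I_m$; $\operatorname{dom}_m r\subseteq M_m(\mathbb F)^g$ is the set of $\underline a$ at which all inverses occurring in $r$ exist; $\operatorname{dom}r=\bigcup_m\operatorname{dom}_mr$. If $\operatorname{dom}r\neq\emptyset$ and $r(\underline a)=0$ for all $\underline a\in\operatorname{dom}r$, then $r$ is called a rational identity. For $r\in\mathcal R_{\mathbb F}(\underline z)$ put $$\varkappa(r)=\#\text{constant terms}+2\cdot\#\text{letters}+\#\text{inversions},$$ counting occurrences of symbols in the string determining $r$ (signs and scalar coefficients multiplying a subexpression are not counted). For example, $\varkappa\big((z_1z_2-z_2z_1)^{-1}\big)=9$. *)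

(* Defs.v *)
From mathcomp Require Import all_boot all_algebra.

Set Implicit Arguments.
Unset Strict Implicit.
Unset Printing Implicit Defensive.

Import GRing.Theory.
Local Open Scope ring_scope.

(* Noncommutative rational expressions over F in g letters, as syntax trees.
   Nodes are syntactic: nothing is identified modulo ring axioms.  RScale c r
   is a subexpression carrying a scalar coefficient (a sign is c = -1); it is
   separate from RMul (RConst c) r because coefficients are not counted in
   [kappa] while constant terms are.  Noncommutative polynomials are the
   trees without RInv. *)
Inductive ratexpr (F : Type) (g : nat) : Type :=
| RConst of F
| RVar of 'I_g
| RScale of F & ratexpr F g
| RAdd of ratexpr F g & ratexpr F g
| RMul of ratexpr F g & ratexpr F g
| RInv of ratexpr F g.

(* Since invmx is total, the value is meaningful only where [in_dom] holds. *)
Fixpoint reval (F : fieldType) (g n : nat) (a : 'I_g -> 'M[F]_n)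
    (r : ratexpr F g) : 'M[F]_n :=
  match r with
  | RConst c => c%:M
  | RVar j => a j
  | RScale c r1 => c *: reval a r1
  | RAdd r1 r2 => reval a r1 + reval a r2
  | RMul r1 r2 => reval a r1 *m reval a r2
  | RInv r1 => invmx (reval a r1)
  end.

Fixpoint in_dom (F : fieldType) (g n : nat) (a : 'I_g -> 'M[F]_n)
    (r : ratexpr F g) : bool :=
  match r with
  | RConst _ | RVar _ => true
  | RScale _ r1 => in_dom a r1
  | RAdd r1 r2 | RMul r1 r2 => in_dom a r1 && in_dom a r2
  | RInv r1 => in_dom a r1 && (reval a r1 \in unitmx)
  end.

Definition dom_nonempty (F : fieldType) (g n : nat) (r : ratexpr F g) : Prop :=
  exists a : 'I_g -> 'M[F]_n, in_dom a r.

Definition vanishes_on_dom (F : fieldType) (g n : nat) (r : ratexpr F g) :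
    Prop :=
  forall a : 'I_g -> 'M[F]_n, in_dom a r -> reval a r = 0.

(* The size 0 is excluded: every 0 x 0 matrix is invertible, so dom_0 is never
   empty. *)
Definition rational_identity (F : fieldType) (g : nat) (r : ratexpr F g) :
    Prop :=
  (exists n : nat, (0 < n)%N /\ dom_nonempty n r) /\
  (forall n : nat, (0 < n)%N -> vanishes_on_dom n r).

Fixpoint kappa (F : Type) (g : nat) (r : ratexpr F g) : nat :=
  match r with
  | RConst _ => 1
  | RVar _ => 2
  | RScale _ r1 => kappa r1
  | RAdd r1 r2 | RMul r1 r2 => (kappa r1 + kappa r2)%N
  | RInv r1 => (kappa r1).+1
  end.

(* Main.v *)
Require Import Defs.
From mathcomp Require Import all_boot all_algebra.
From mathcomp Require Import mxtens zify.

(** The idea is to turn [r] into a linear system, expand the solution of that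
    system around the given point [p] of the domain, and observe that the
    expansion is controlled by finitely many coefficients, all of which are
    visible on matrices of size [m * uphalf (m * kappa r)].

    Linearization.  Every [r] has affine matrix data of dimension
    [d = kappa r] such that, at each point [a] of the domain, the operator
    [pencil a] on [F^n (x) F^d] is injective and [r(a) v] is a fixed linear
    functional of the solution of [pencil a x = v b] ([linearization]).  The
    weights in the definition of [kappa] are exactly the dimensions needed for
    a constant, a letter and an inversion.

    Expansion.  At [p] the operator [pencil p] is an invertible matrix [P] of
    size [m * d].  Replacing [p] by [p (x) 1 - t Y], where [Y] is an
    [m x m] block matrix of [s x s] blocks, the system becomes a resolvent
    [(1 - t A(Y)) x = B v] with output [C x].  Here [A(Y)] is the sum of the
    [A_l (x) y_l] over the letters [l = (j, u, v)], with [y_l] the block of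
    [Y_j] at position [(u, v)].  If [r] vanishes
    on its domain in size [m * s], then the output is zero for all but finitely
    many [t], because the domain contains [p (x) 1] and membership is a generic
    condition on a line ([generic_in_dom]).  Hence [C A(Y)^k B = 0] for all
    [k] and [Y] ([resolvent_moments]).

    Separation of words.  A nonzero noncommutative polynomial of degree less
    than [2 s] does not vanish on [s x s] matrices: the staircase
    [e_11, e_12, e_22, e_23, ...] has [2 s - 1] matrix units and a nonzero
    product in one order only.  After polarization this isolates each single
    coefficient, so [C A_w B = 0] for every word [w] of length less than
    [2 s] ([staircase_extraction], [words_vanish]).

    Finiteness.  As the [A_l] act on a space of dimension [m * d <= 2 s],
    the words shorter than that dimension already generate the smallest
    invariant subspace [W] containing the image of [B], and so [C] kills all of
    [W] ([krylov]).

    Conclusion.  Let [a] be any point of the domain, of any size [n].  The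
    system for [1 (x) a] is again of the form [(1 - A(Y)) x = B v], with
    [Y = p (x) 1 - 1 (x) a].  Its operator is injective and preserves
    [W (x) F^n], a finite-dimensional space containing the right-hand side, so
    the solution lies there and the output [u (x) r(a) v] is zero
    ([represented_vanish]). *)

Set Implicit Arguments.
Unset Strict Implicit.
Unset Printing Implicit Defensive.
Import GRing.Theory.
Local Open Scope ring_scope.

(** * Linearization of rational expressions *)

(** The operator [L0^T (x) 1 + sum_j (L j)^T (x) a j] on [F^d (x) F^n], with that
    space realized as [n x d] matrices: the pencil acts on the right and the
    point on the left, which avoids Kronecker products. *)
Definition pencil (F : fieldType) (g n d : nat) (a : 'I_g -> 'M[F]_n)
    (L0 : 'M[F]_d) (L : 'I_g -> 'M[F]_d) (x : 'M[F]_(n, d)) : 'M[F]_(n, d) :=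
  x *m L0 + \sum_j a j *m x *m L j.

(** The system [pencil a x = v *m b] realizes [reval a r] as the transfer map
    from [v] to [x *m c].  Stating this through solutions rather than inverse
    matrices makes each construction below a block-triangular elimination. *)
Definition represents (F : fieldType) (g d : nat) (r : ratexpr F g)
    (L0 : 'M[F]_d) (L : 'I_g -> 'M[F]_d) (b : 'rV[F]_d) (c : 'cV[F]_d) : Prop :=
  forall (n : nat) (a : 'I_g -> 'M[F]_n), in_dom a r ->
    (forall x, pencil a L0 L x = 0 -> x = 0) /\
    (forall x (v : 'cV_n), pencil a L0 L x = v *m b -> x *m c = reval a r *m v).

Lemma pencil_const0 (F : fieldType) (g n d : nat) (a : 'I_g -> 'M[F]_n)
  (L0 : 'M[F]_d) x : pencil a L0 (fun=> 0) x = x *m L0.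
Proof. by rewrite /pencil big1 ?addr0 // => j _; rewrite mulmx0. Qed.

Lemma pencil_block (F : fieldType) (g n d1 d2 : nat) (a : 'I_g -> 'M[F]_n)
  (A : 'M[F]_d1) B C (D : 'M[F]_d2) L1 L2 x1 x2 :
  pencil a (block_mx A B C D) (fun j => block_mx (L1 j) 0 0 (L2 j))
    (row_mx x1 x2) =
  row_mx (pencil a A L1 x1 + x2 *m C) (pencil a D L2 x2 + x1 *m B).
Proof.
rewrite /pencil mul_row_block.
under eq_bigr => j _ do rewrite mul_mx_row mul_row_block !mulmx0 addr0 add0r.
have -> : \sum_j row_mx (a j *m x1 *m L1 j) (a j *m x2 *m L2 j)
  = row_mx (\sum_j a j *m x1 *m L1 j) (\sum_j a j *m x2 *m L2 j).
  elim/big_rec3: _ => [|j u v w _ ->]; first by rewrite row_mx0.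
  by rewrite add_row_mx.
by rewrite add_row_mx addrAC (addrC (x1 *m B)) [in X in row_mx _ X]addrAC.
Qed.

Lemma represents_const (F : fieldType) (g : nat) (k : F) :
  represents (RConst g k) 1%:M (fun=> 0) (1%:M : 'rV_1) (k%:M : 'cV_1).
Proof.
move=> n a _; split=> [x|x v]; rewrite pencil_const0 !mulmx1 //.
by move=> ->; rewrite mul_mx_scalar mul_scalar_mx.
Qed.

(** The two block equations are [x1 - a_i x2 = 0] and [x2 = v]. *)
Lemma represents_var (F : fieldType) (g : nat) (i : 'I_g) :
  represents (RVar F i) (1%:M : 'M_(1 + 1))
    (fun j => block_mx 0 0 (- (j == i)%:R%:M) 0)
    (row_mx 0 1%:M) (col_mx 1%:M 0).
Proof.
move=> n a _.
have pE (x1 x2 : 'cV_n) : pencil a (1%:M : 'M_(1 + 1))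
   (fun j => block_mx 0 0 (- (j == i)%:R%:M) 0) (row_mx x1 x2)
   = row_mx (x1 - a i *m x2) x2.
  rewrite /pencil mulmx1.
  under eq_bigr => j _ do
    rewrite mul_mx_row mul_row_block !mulmx0 !add0r mulmxN mul_mx_scalar.
  rewrite (bigD1 i) //= big1 => [|j /negbTE ->]; last first.
    by rewrite scale0r oppr0 row_mx0.
  by rewrite eqxx scale1r addr0 add_row_mx addr0.
split=> [x|x v]; rewrite -[x]hsubmxK pE -?row_mx0 ?mul_mx_row ?mulmx0 ?mulmx1;
  case/eq_row_mx => e1 e2.
  by move: e1; rewrite e2 mulmx0 subr0 => ->.
by rewrite mul_row_col mulmx0 addr0 mulmx1 /= -e2; apply/eqP; rewrite -subr_eq0 e1.
Qed.

Lemma represents_scale (F : fieldType) (g d : nat) (k : F) (r : ratexpr F g)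
  (L0 : 'M_d) L b c :
  represents r L0 L b c -> represents (RScale k r) L0 L b (k *: c).
Proof.
move=> h n a /= /h [inj sol]; split=> // x v /sol e.
by rewrite -scalemxAr e scalemxAl.
Qed.

Lemma represents_add (F : fieldType) (g d1 d2 : nat) (r1 r2 : ratexpr F g)
  (A : 'M_d1) L1 b1 c1 (D : 'M_d2) L2 b2 c2 :
  represents r1 A L1 b1 c1 -> represents r2 D L2 b2 c2 ->
  represents (RAdd r1 r2) (block_mx A 0 0 D)
    (fun j => block_mx (L1 j) 0 0 (L2 j)) (row_mx b1 b2) (col_mx c1 c2).
Proof.
move=> h1 h2 n a /= /andP[/h1 [i1 s1] /h2 [i2 s2]].
split=> [x|x v]; rewrite -[x]hsubmxK pencil_block !mulmx0 !addr0
  -?row_mx0 ?mul_mx_row; case/eq_row_mx.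
  by move=> /i1 -> /i2 ->.
by move=> /s1 e1 /s2 e2; rewrite mul_row_col e1 e2 mulmxDl.
Qed.

(** The second block solves the system of [r2] for [v]; its output
    [x2 *m c2] is fed to the first block as the input of [r1]. *)
Lemma represents_mul (F : fieldType) (g d1 d2 : nat) (r1 r2 : ratexpr F g)
  (A : 'M_d1) L1 b1 c1 (D : 'M_d2) L2 b2 c2 :
  represents r1 A L1 b1 c1 -> represents r2 D L2 b2 c2 ->
  represents (RMul r1 r2) (block_mx A 0 (- (c2 *m b1)) D)
    (fun j => block_mx (L1 j) 0 0 (L2 j)) (row_mx 0 b2) (col_mx c1 0).
Proof.
move=> h1 h2 n a /= /andP[/h1 [i1 s1] /h2 [i2 s2]].
split=> [x|x v]; rewrite -[x]hsubmxK pencil_block mulmxN !mulmx0 !addr0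
  -?row_mx0 ?mul_mx_row; case/eq_row_mx.
  by move=> e1 /i2 e2; move: e1; rewrite e2 mul0mx subr0 => /i1 ->.
rewrite mulmx0 mulmxA => /eqP; rewrite subr_eq0 => /eqP e1 /s2 e2.
by rewrite mul_row_col mulmx0 addr0 (s1 _ _ e1) e2 mulmxA.
Qed.

(** The new unknown [y], in the first column, is the input of the system of
    [r]; the added equation asks that the output [x *m c = r(a) y] be [v].
    Hence [y] is [r(a)^-1 v]. *)
Lemma represents_inv (F : fieldType) (g d : nat) (r : ratexpr F g)
  (L0 : 'M_d) L b c :
  represents r L0 L b c ->
  represents (RInv r) (block_mx 0 (- b) c L0)
    (fun j => block_mx (0 : 'M_1) 0 0 (L j)) (row_mx 1%:M 0) (col_mx 1%:M 0).
Proof.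
move=> h n a /= /andP[/h [inj sol] u].
have key (y v : 'cV_n) x :
    pencil a (0 : 'M_1) (fun=> 0) y + x *m c = v ->
    pencil a L0 L x + y *m - b = 0 -> y = invmx (reval a r) *m v.
  rewrite pencil_const0 mulmx0 add0r mulmxN => <- /eqP.
  by rewrite subr_eq0 => /eqP /sol ->; rewrite mulmxA mulVmx ?mul1mx.
split=> [x|x v]; rewrite -[x]hsubmxK pencil_block -?row_mx0 ?mul_mx_row;
  case/eq_row_mx; rewrite ?mulmx0 ?mulmx1 => e1 e2; have y0 := key _ _ _ e1 e2.
  rewrite y0 mulmx0; move: e2; rewrite y0 mulmx0 mul0mx addr0 => /inj ->.
  by rewrite row_mx0.
by rewrite mul_row_col mulmx0 addr0 mulmx1.
Qed.

(** The dimension is exactly [kappa r] since block sums add dimensions and an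
    inversion adds one row. *)
Lemma linearization (F : fieldType) (g : nat) (r : ratexpr F g) :
  exists (L0 : 'M[F]_(kappa r)) L b c, represents r L0 L b c.
Proof.
elim: r => [k|i|k r|r1|r1|r] /=.
- by do 4!eexists; apply: represents_const.
- by do 4!eexists; apply: represents_var.
- by move=> [A [L [b [c h]]]]; do 4!eexists; apply: represents_scale h.
- move=> [A [L [b [c h]]]] r2 [A' [L' [b' [c' h']]]].
  by do 4!eexists; apply: represents_add h h'.
- move=> [A [L [b [c h]]]] r2 [A' [L' [b' [c' h']]]].
  by do 4!eexists; apply: represents_mul h h'.
- move=> [A [L [b [c h]]]].
  by do 4!eexists; apply: represents_inv h.
Qed.

(** * Pencils as operators *)

Definition pencil_mx (F : fieldType) (g n d : nat) (a : 'I_g -> 'M[F]_n)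
    (L0 : 'M[F]_d) (L : 'I_g -> 'M[F]_d) : 'M[F]_(n * d) :=
  lin_mulmxr L0 + \sum_j lin_mulmx (a j) *m lin_mulmxr (L j).

Lemma mul_pencil_mx (F : fieldType) (g n d : nat) (a : 'I_g -> 'M[F]_n)
  (L0 : 'M_d) L (x : 'M_(n, d)) :
  mxvec x *m pencil_mx a L0 L = mxvec (pencil a L0 L x).
Proof.
rewrite mulmxDr mul_vec_lin /= /pencil linearD; congr (_ + _).
rewrite mulmx_sumr (linear_sum mxvec); apply: eq_bigr => j _.
by rewrite mulmxA !mul_vec_lin.
Qed.

Lemma pencil_mx_unit (F : fieldType) (g n d : nat) (a : 'I_g -> 'M[F]_n)
  (L0 : 'M_d) L :
  (forall x : 'M_(n, d), pencil a L0 L x = 0 -> x = 0) ->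
  pencil_mx a L0 L \in unitmx.
Proof.
move=> inj; rewrite -row_free_unit -kermx_eq0; apply/eqP/row_matrixP => i.
have : row i (kermx (pencil_mx a L0 L)) *m pencil_mx a L0 L = 0.
  by rewrite -row_mul mulmx_ker row0.
rewrite row0 -[row i _]vec_mxK mul_pencil_mx => e.
by rewrite (inj (vec_mx _)) ?linear0 //; apply: (can_inj mxvecK); rewrite e linear0.
Qed.

Lemma pencil_surj (F : fieldType) (g n d : nat) (a : 'I_g -> 'M[F]_n)
  (L0 : 'M_d) L (y : 'M_(n, d)) :
  (forall x : 'M_(n, d), pencil a L0 L x = 0 -> x = 0) ->
  exists x, pencil a L0 L x = y.
Proof.
move/pencil_mx_unit => u; exists (vec_mx (mxvec y *m invmx (pencil_mx a L0 L))).
by apply: (can_inj mxvecK); rewrite -mul_pencil_mx vec_mxK mulmxKV.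
Qed.

(** A change of the [F^d] factor commutes with the action of the point, which
    touches only the [F^n] factor. *)
Lemma pencil_intertwine (F : fieldType) (g n d d' : nat) (a : 'I_g -> 'M[F]_n)
  (L0 : 'M_d) L (K0 : 'M_d') K (S : 'M_(d, d')) (x : 'M_(n, d)) :
  L0 *m S = S *m K0 -> (forall j, L j *m S = S *m K j) ->
  pencil a L0 L x *m S = pencil a K0 K (x *m S).
Proof.
move=> e0 e; rewrite /pencil mulmxDl -mulmxA e0 mulmxA mulmx_suml.
by congr (_ + _); apply: eq_bigr => j _; rewrite -!mulmxA e.
Qed.

(** The pencil maps [F^n (x) W] into itself, injectively, hence onto itself by
    finiteness of the dimension; so the only preimage of an element of
    [F^n (x) W] lies there.  Expressing the restriction in a basis of [W] gives
    another pencil, to which [pencil_surj] applies. *)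
Lemma pencil_inj_sub (F : fieldType) (g n d k : nat) (a : 'I_g -> 'M[F]_n)
  (L0 : 'M[F]_d) L (W : 'M[F]_(k, d)) (x : 'M_(n, d)) :
  (forall x, pencil a L0 L x = 0 -> x = 0) ->
  (W *m L0 <= W)%MS -> (forall j, (W *m L j <= W)%MS) ->
  (pencil a L0 L x <= W)%MS -> (x <= W)%MS.
Proof.
move=> inj s0 s; pose w := row_base W.
have stab (M : 'M_d) : (W *m M <= W)%MS -> w *m M = w *m M *m pinvmx w *m w.
  move=> h; rewrite mulmxKpV // eq_row_base.
  by apply: submx_trans h; rewrite submxMr ?eq_row_base.
have wfree : row_free w by exact: row_base_free.
have tw (y : 'M_(n, _)) : pencil a (w *m L0 *m pinvmx w)
    (fun j => w *m L j *m pinvmx w) y *m w = pencil a L0 L (y *m w).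
  by apply: pencil_intertwine => [|j]; rewrite -stab.
rewrite -(eq_row_base W) => /submxP [z ez].
have [|y ey] := @pencil_surj F g n _ a (w *m L0 *m pinvmx w)
    (fun j => w *m L j *m pinvmx w) z.
  move=> y y0; apply: (row_free_inj wfree); rewrite mul0mx.
  by apply: inj; rewrite -tw y0 mul0mx.
have -> : x = y *m w.
  apply/eqP; rewrite -subr_eq0; apply/eqP/inj.
  have -> : pencil a L0 L (x - y *m w) = pencil a L0 L x - pencil a L0 L (y *m w).
    rewrite /pencil mulmxBl opprD addrACA -sumrB; congr (_ + _).
    by apply: eq_bigr => j _; rewrite mulmxBr mulmxBl.
  by rewrite -tw ey ez subrr.
by rewrite -(eq_row_base W) submxMl.
Qed.

(** * The domain of a rational expression *)

Lemma eq_reval (F : fieldType) (g n : nat) (a b : 'I_g -> 'M[F]_n)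
  (r : ratexpr F g) :
  a =1 b -> reval a r = reval b r /\ in_dom a r = in_dom b r.
Proof.
move=> e; elim: r => [k|i|k r [IH ID]|r1 [IH1 ID1] r2 [IH2 ID2]
    |r1 [IH1 ID1] r2 [IH2 ID2]|r [IH ID]] //=;
  by rewrite ?IH ?ID ?IH1 ?IH2 ?ID1 ?ID2.
Qed.

(** Along a polynomial curve, the value of [r] is a matrix of polynomials over
    a common denominator [q], and the only obstruction met by an inversion is
    the determinant of the numerator; it is nonzero at [t0], so it can be
    absorbed into [q]. *)
Lemma generic_in_dom (F : fieldType) (g n : nat) (t0 : F)
  (X : 'I_g -> 'M[{poly F}]_n) (r : ratexpr F g) :
  let Xat t j := map_mx (horner_eval t) (X j) in
  in_dom (Xat t0) r ->
  exists (q : {poly F}) (Q : 'M[{poly F}]_n), q.[t0] != 0 /\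
    forall t, q.[t] != 0 ->
      in_dom (Xat t) r /\
      q.[t] *: reval (Xat t) r = map_mx (horner_eval t) Q.
Proof.
move=> Xat; elim: r => [k|i|k r IH|r1 IH1 r2 IH2|r1 IH1 r2 IH2|r IH] /=.
- move=> _; exists 1, k%:P%:M; rewrite hornerE oner_neq0; split=> // t _.
  by rewrite hornerE scale1r map_scalar_mx /= /horner_eval hornerC.
- move=> _; exists 1, (X i); rewrite hornerE oner_neq0; split=> // t _.
  by rewrite hornerE scale1r.
- move=> /IH [q [Q [q0 h]]]; exists q, (k%:P *: Q); split=> // t /h [d e].
  by split=> //; rewrite scalerA mulrC -scalerA e map_mxZ /= /horner_eval hornerC.
- case/andP => /IH1 [q1 [Q1 [q10 h1]]] /IH2 [q2 [Q2 [q20 h2]]].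
  exists (q1 * q2), (q2 *: Q1 + q1 *: Q2); rewrite hornerM mulf_neq0 //.
  split=> // t; rewrite hornerM mulf_eq0 negb_or.
  case/andP=> /h1 [d1 e1] /h2 [d2 e2]; rewrite d1 d2; split=> //.
  rewrite map_mxD !map_mxZ -e1 -e2 /= /horner_eval !scalerA scalerDr.
  by rewrite [q2.[t] * _]mulrC.
- case/andP => /IH1 [q1 [Q1 [q10 h1]]] /IH2 [q2 [Q2 [q20 h2]]].
  exists (q1 * q2), (Q1 *m Q2); rewrite hornerM mulf_neq0 //.
  split=> // t; rewrite hornerM mulf_eq0 negb_or.
  case/andP=> /h1 [d1 e1] /h2 [d2 e2]; rewrite d1 d2; split=> //.
  by rewrite map_mxM -e1 -e2 -scalemxAl -scalemxAr scalerA.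
- case/andP => /IH [q [Q [q0 h]]] u.
  have detE t : q.[t] != 0 -> (\det Q).[t] = q.[t] ^+ n * \det (reval (Xat t) r).
    move=> /h [_ e]; rewrite -detZ e.
    by rewrite -[LHS]/(horner_eval t (\det Q)) -det_map_mx.
  exists (q * \det Q), (q ^+ 2 *: \adj Q); split.
    rewrite hornerM mulf_neq0 // detE // mulf_neq0 ?expf_neq0 //.
    by rewrite -unitfE -unitmxE.
  move=> t; rewrite hornerM mulf_eq0 negb_or => /andP[qt].
  have [d e] := h _ qt.
  move=> dt; have ut : reval (Xat t) r \in unitmx.
    rewrite unitmxE unitfE; apply: contraNneq dt => dt0.
    by rewrite detE // dt0 mulr0.
  rewrite d ut; split=> //.
  apply: (can_inj (mulmxK ut)).
  have -> : map_mx (horner_eval t) (q ^+ 2 *: \adj Q)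
      = q.[t] ^+ 2 *: map_mx (horner_eval t) (\adj Q).
    by apply/matrixP => i j; rewrite !mxE /horner_eval hornerM horner_exp.
  rewrite -scalemxAl mulVmx //.
  rewrite [in RHS]expr2 -[in RHS]scalerA -!scalemxAl scalemxAr e -map_mxM.
  by rewrite mul_adj_mx map_scalar_mx !scale_scalar_mx mulr1.
Qed.

(** Evaluation commutes with the unital ring homomorphism [A |-> A (x) 1]. *)
Lemma ampliation (F : fieldType) (g m s : nat) (p : 'I_g -> 'M[F]_m)
  (r : ratexpr F g) :
  in_dom p r ->
  in_dom (fun j => p j *t (1%:M : 'M_s)) r /\
  reval (fun j => p j *t (1%:M : 'M_s)) r = reval p r *t 1%:M.
Proof.
have tensD (A B : 'M[F]_m) : (A + B) *t (1%:M : 'M_s) = A *t 1%:M + B *t 1%:M.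
  by apply/matrixP => i j; rewrite !mxE mulrDl.
have tensZ c (A : 'M[F]_m) : (c *: A) *t (1%:M : 'M_s) = c *: (A *t 1%:M).
  by apply/matrixP => i j; rewrite !mxE mulrA.
have tens1 : (1%:M : 'M_m) *t (1%:M : 'M_s) = 1%:M :> 'M[F]__.
  apply/matrixP => i j.
  case: (mxtens_indexP i) => i1 i2; case: (mxtens_indexP j) => j1 j2.
  rewrite tensmxE !mxE -natrM mulnb (can_eq (@mxtens_indexK _ _)).
  by rewrite xpair_eqE.
elim: r => [c|i|c r IH|r1 IH1 r2 IH2|r1 IH1 r2 IH2|r IH] //=.
- by rewrite -[c%:M in RHS]scalemx1 tensZ tens1 scalemx1.
- by move=> /IH [-> ->]; rewrite tensZ.
- by move=> /andP[/IH1 [-> ->] /IH2 [-> ->]]; rewrite tensD.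
- by move=> /andP[/IH1 [-> ->] /IH2 [-> ->]]; rewrite tensmx_mul mulmx1.
- move=> /andP[/IH [-> ->] u].
  have inv : (reval p r *t (1%:M : 'M_s)) *m (invmx (reval p r) *t 1%:M) = 1%:M.
    by rewrite tensmx_mul mulmxV // mulmx1.
  have [u' _] := mulmx1_unit inv; rewrite u'; split=> //.
  by rewrite -(mulKmx u' (invmx (reval p r) *t _)) inv mulmx1.
Qed.

(** * From resolvents to words *)

(** Characteristic zero enters here: the images of the natural numbers are
    more roots than a nonzero [q * f] can have. *)
Lemma poly_eq0_generic (F : fieldType) (hF : [pchar F] =i pred0)
  (q f : {poly F}) :
  q != 0 -> (forall t, q.[t] != 0 -> f.[t] = 0) -> f = 0.
Proof.
move=> q0 h; suff /eqP : q * f = 0 by rewrite mulf_eq0 (negbTE q0) => /eqP.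
apply/eqP; apply: contraT => nz.
pose s := [seq (i%:R : F) | i <- iota 0 (size (q * f))].
have: (size s < size (q * f)%R)%N.
  apply: max_poly_roots nz _ _.
    apply/allP => t _; rewrite /root hornerM.
    by have [->|/h ->] := eqVneq q.[t] 0; rewrite ?mul0r ?mulr0.
  rewrite map_inj_uniq ?iota_uniq // => i j e.
  wlog le_ij : i j e / (i <= j)%N.
    by move=> H; case/orP: (leq_total i j) => /H // ->.
  move/eqP: e; rewrite eq_sym -subr_eq0 -natrB // => /eqP e.
  apply/eqP; rewrite eqn_leq le_ij /= -subn_eq0.
  have/pcharf0P := hF; move=> /(_ (j - i)%N).
  by rewrite e eqxx.
by rewrite size_map size_iota ltnn.
Qed.

(** Formally [x = sum_k t^k w A^k], so [x h = 0] for generic [t] says that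
    every moment [w A^k h] is zero.  For [k = 0]: by Cramer's rule
    [w adj(1 - t A) h] is a polynomial in [t] that vanishes generically, hence
    at [t = 0].  The step from [k] to [k + 1] replaces [w] by [w A] and [x] by
    [x A], which again solves the system because [t x A = x - w]. *)
Lemma resolvent_moments (F : fieldType) (hF : [pchar F] =i pred0) (n l : nat)
  (A : 'M[F]_n) (h : 'M[F]_(n, l)) (w : 'rV[F]_n) (q : {poly F}) :
  q != 0 ->
  (forall t, q.[t] != 0 ->
     exists x : 'rV_n, x - t *: (x *m A) = w /\ x *m h = 0) ->
  forall k, w *m A ^+ k *m h = 0.
Proof.
have base (w0 : 'rV[F]_n) (q1 : {poly F}) :
    q1 != 0 ->
    (forall t, q1.[t] != 0 ->
       exists x : 'rV_n, x - t *: (x *m A) = w0 /\ x *m h = 0) ->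
    w0 *m 1%:M *m h = 0.
  move=> q10 sol; rewrite mulmx1; apply/matrixP => i j; rewrite ord1 [RHS]mxE.
  pose T := 1%:M - 'X *: map_mx polyC A.
  pose f := map_mx polyC w0 *m \adj T *m map_mx polyC h.
  have evC t k1 k2 (B : 'M[F]_(k1, k2)) :
      map_mx (horner_eval t) (map_mx polyC B) = B.
    by apply/matrixP => u v; rewrite !mxE /= /horner_eval hornerC.
  have fE t : map_mx (horner_eval t) f = w0 *m \adj (1%:M - t *: A) *m h.
    rewrite /f !map_mxM !evC map_mx_adj map_mxB map_mx1 map_mxZ evC /=.
    by rewrite /horner_eval hornerX.
  have f0 : f 0 j = 0.
    apply: poly_eq0_generic hF _ _ q10 _ => t /sol [x [xw xh]].
    have /matrixP/(_ 0 j) := fE t.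
    rewrite mxE /= /horner_eval => ->; rewrite -xw.
    have -> : x - t *: (x *m A) = x *m (1%:M - t *: A).
      by rewrite mulmxBr mulmx1 -scalemxAr.
    rewrite -!mulmxA (mulmxA (_ - _)) mul_mx_adj mul_scalar_mx.
    by rewrite -scalemxAr xh scaler0 mxE.
  have /matrixP/(_ 0 j) := fE 0.
  by rewrite mxE f0 /= /horner_eval horner0 scale0r subr0 adj1 mulmx1 => <-.
move=> q0 sol k; elim: k w q q0 sol => [|k IH] w q q0 sol.
  exact: (base _ _ q0 sol).
have wh : w *m h = 0 by rewrite -(mulmx1 w); apply: (base w q).
have -> : w *m A ^+ k.+1 = w *m A *m A ^+ k by rewrite exprS; apply: mulmxA.
apply: (IH _ (q * 'X)); first by rewrite mulf_neq0 ?polyX_eq0.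
move=> t; rewrite hornerM hornerX mulf_eq0 negb_or => /andP[/sol [x [xw xh]] t0].
have xA : t *: (x *m A) = x - w by rewrite -xw opprB addrC subrK.
exists (x *m A); split; first by rewrite scalemxAl -mulmxBl xA subKr.
by apply: (scalerI t0); rewrite scaler0 scalemxAl xA mulmxBl xh wh subrr.
Qed.

(** Polarization without signs: by induction on [S], the terms whose support
    is a proper subset of [S] already cancel. *)
Lemma sum_exact_support (I T : finType) (V : zmodType) (supp : T -> {set I})
  (u : T -> V) :
  (forall S : {set I}, \sum_(x | supp x \subset S) u x = 0) ->
  forall S : {set I}, \sum_(x | supp x == S) u x = 0.
Proof.
move=> h S; have [n] := ubnP #|S|; elim: n S => // n IH S lt_n.
have := h S; rewrite (bigID (fun x => supp x == S)) /=.
rewrite [X in _ + X](partition_big supp (fun S' => S' \proper S)) /=; last first.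
  by move=> x /andP[le ne]; rewrite properEneq ne le.
rewrite [X in _ + X]big1 ?addr0; last first.
  move=> S' lt; rewrite -[RHS](IH S'); last first.
    exact: leq_trans (proper_card lt) _.
  apply: eq_bigl => x; case: (supp x =P S') => [->|]; rewrite ?andbF ?andbT //.
  by rewrite andbC -properEneq.
move=> e; rewrite -[RHS]e; apply: eq_bigl => x.
by case: eqP => [->|]; rewrite ?subxx ?andbF.
Qed.

(** The staircase of matrix units [e_00, e_10, e_11, e_21, e_22, ...].  It is
    descending since [prod_sandwich] multiplies the left factors of a word in
    reverse order. *)
Definition stair (R : pzRingType) (s l : nat) : 'M[R]_s.+1 :=
  delta_mx (inord (uphalf l)) (inord l./2).

(** If [b] comes right after [a] in a word with nonzero product, then
    [b./2 = uphalf a], whence [b >= a]; distinct letters make it strict. *)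
Lemma stair_prod_sorted (R : pzRingType) (s : nat) (w : seq nat) :
  uniq w -> all (fun l => l <= s.*2)%N w ->
  \prod_(l <- rev w) stair R s l != 0 -> sorted ltn w.
Proof.
elim: w => // a w IH /= /andP[aw uw] /andP[la lw].
rewrite rev_cons big_rcons /= => nz.
have nzw : \prod_(l <- rev w) stair R s l != 0.
  by apply: contraNneq nz => ->; rewrite mul0r.
have := IH uw lw nzw; case: w {IH nzw} aw uw lw nz => //= b w.
rewrite inE negb_or => /andP[ab _] _ /andP[lb _] nz ->; rewrite andbT.
suff e : b./2 = uphalf a by lia.
apply: contraNeq nz => ne; rewrite rev_cons big_rcons /= -mulrA.
rewrite [_ * stair R s a](_ : _ = 0) ?mulr0 //.
rewrite /stair -[LHS]/(_ *m _) mul_delta_mx_0 //.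
apply: contra_neq ne => /(congr1 val); rewrite /= !inordK //; lia.
Qed.

Lemma stair_prod_iota (R : pzRingType) (s k l : nat) (i : 'I_l) :
  (k <= s.*2.+1)%N ->
  (\prod_(j <- rev (iota 0 k)) stair R s j) *m delta_mx 0 i
    = delta_mx (inord k./2) i.
Proof.
elim: k => [_|k IH lk].
  rewrite big_nil mul1mx; congr delta_mx; apply: val_inj; by rewrite /= inordK.
have -> : iota 0 k.+1 = rcons (iota 0 k) k by rewrite -cats1 -addn1 iotaD.
rewrite rev_rcons big_cons -[_ *m _]mulmxA IH 1?ltnW //.
by rewrite /stair mul_delta_mx.
Qed.

(** Stated for an arbitrary operation: the product of matrices is not
    commutative, so the order of the enumeration matters. *)
Lemma big_ord_enum (R : Type) (idx : R) (op : R -> R -> R) k (f : 'I_k -> R) :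
  \big[op/idx]_(i <- enum 'I_k) f i = \big[op/idx]_i f i.
Proof. by rewrite enumT [index_enum _]unlock. Qed.

Lemma prod_sandwich (R : comPzRingType) (s d : nat) (I : Type)
  (e : I -> 'M[R]_s) (A : I -> 'M[R]_d) (w : seq I) (x : 'M_(s, d)) :
  mxvec x *m \prod_(i <- w) (lin_mulmx (e i) *m lin_mulmxr (A i))
   = mxvec ((\prod_(i <- rev w) e i) *m x *m \prod_(i <- w) A i).
Proof.
elim: w x => [|i w IH] x; first by rewrite !big_nil mul1mx !mulmx1.
rewrite big_cons [LHS]mulmxA mulmxA !mul_vec_lin /= IH.
by rewrite rev_cons big_rcons big_cons /= !mulmxA.
Qed.

(** The moments of the sandwich operators [x |-> sum_(i in S) e_i x A_i] vanish
    for every [S].  Expanding the [k]-th moment over maps [f] from ['I_k] to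
    [S] and polarizing leaves the surjective [f], that is the permutations;
    the staircase kills all of them but the identity, whose term is a nonzero
    matrix unit times [B A_0 ... A_(k-1) C]. *)
Lemma staircase_extraction (F : fieldType) (hF : [pchar F] =i pred0)
  (s k d m l : nat) (A : 'I_k -> 'M[F]_d) (B : 'M[F]_(m, d)) (C : 'M[F]_(d, l)) :
  (k <= s.*2.+1)%N ->
  (forall (S : {set 'I_k}) (V : 'M_(s.+1, m)), exists2 q : {poly F}, q != 0 &
    forall t, q.[t] != 0 -> exists x : 'M_(s.+1, d),
      x - t *: (\sum_(i in S) stair F s i *m x *m A i) = V *m B /\ x *m C = 0) ->
  B *m (\prod_i A i) *m C = 0.
Proof.
move=> lk sol.
pose z (i : 'I_k) := lin_mulmx (stair F s i) *m lin_mulmxr (A i).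
have zE x i : mxvec x *m z i = mxvec (stair F s i *m x *m A i).
  by rewrite mulmxA !mul_vec_lin.
have mom (S : {set 'I_k}) (V : 'M_(s.+1, m)) :
    mxvec (V *m B) *m (\sum_(i in S) z i) ^+ k *m lin_mulmxr C = 0.
  have [q q0 h] := sol S V; apply: (resolvent_moments hF q0) => t /h [x [e xC]].
  exists (mxvec x); rewrite mul_vec_lin /= xC linear0; split=> //.
  rewrite -e [RHS]linearB [in RHS]linearZ /= mulmx_sumr (linear_sum mxvec).
  congr (_ - _ *: _).
  by apply: eq_bigr => i _; rewrite zE.
have key V : (\prod_(i <- rev (enum 'I_k)) stair F s (val i)) *m (V *m B)
     *m (\prod_i A i) *m C = 0.
  pose u (f : {ffun 'I_k -> 'I_k}) :=
    mxvec (V *m B) *m (\prod_i z (f i)) *m lin_mulmxr C.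
  have uE f : u f = mxvec ((\prod_(i <- rev (codom f)) stair F s (val i)) *m (V *m B)
     *m (\prod_(i <- codom f) A i) *m C).
    rewrite /u; have -> : \prod_i z (f i) = \prod_(i <- codom f) z i.
      by rewrite /codom /image_mem big_map big_ord_enum.
    by rewrite prod_sandwich mul_vec_lin.
  (* a surjective f is a permutation, and its staircase product vanishes unless
     f is increasing *)
  have u_other (f : {ffun 'I_k -> 'I_k}) :
      f @: setT == setT -> f != [ffun i => i] -> u f = 0.
    move=> im nid; rewrite uE.
    suff -> : \prod_(i <- rev (codom f)) stair F s (val i) = 0.
      by rewrite !mul0mx linear0.
    apply: contraNeq nid => nz; apply/eqP/ffunP => i; rewrite ffunE.
    have finj : injective f.
      have /imset_injP inj : #|f @: setT| == #|[set: 'I_k]| by rewrite (eqP im).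
      by move=> x y; apply: inj; rewrite inE.
    pose w := [seq val i | i <- codom f].
    have uw : uniq w by rewrite (map_inj_uniq val_inj) (map_inj_uniq finj) enum_uniq.
    have lw l0 : l0 \in w -> (l0 < k)%N by case/mapP => j _ ->; apply: ltn_ord.
    have sw : sorted ltn w.
      apply: (@stair_prod_sorted F s); rewrite ?uw //.
        by apply/allP => l0 /lw; lia.
      by rewrite -map_rev big_map.
    have ew : w = iota 0 k.
      apply: (irr_sorted_eq ltn_trans ltnn sw (iota_ltn_sorted 0 k)).
      apply: (uniq_min_size uw _ _).2.
        by move=> l0 /lw; rewrite mem_iota.
      by rewrite size_iota size_map size_codom card_ord.
    have : codom f = [seq id i | i <- enum 'I_k].
      by rewrite map_id; apply: (inj_map val_inj); rewrite val_enum_ord -ew.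
    by move/eq_in_map => ->; rewrite ?mem_enum.
  have := @sum_exact_support _ _ _
    (fun f : {ffun 'I_k -> 'I_k} => f @: setT) u _ setT.
  rewrite (bigD1 [ffun i => i]) /=; last first.
    by apply/eqP/setP => i; rewrite inE; apply/imsetP; exists i; rewrite ?ffunE.
  rewrite big1 ?addr0; last by move=> f /andP[]; apply: u_other.
  have cid : codom [ffun i : 'I_k => i] = enum 'I_k.
    by rewrite /codom /image_mem -[RHS]map_id; apply: eq_map => i; rewrite ffunE.
  rewrite uE cid big_ord_enum => h; apply: (can_inj mxvecK); rewrite linear0 h //.
  move=> S.
  transitivity (\sum_(f in ffun_on (mem S)) u f).
    apply: eq_bigl => f; apply/subsetP/ffun_onP => [sub i|on _ /imsetP[i _ ->]].
      by apply: sub; apply: imset_f.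
    exact: on.
  rewrite -[RHS](mom S V) -mulmx_suml -mulmx_sumr; congr (_ *m _ *m _).
  rewrite -(bigA_distr_big (mem S) (fun (_ : 'I_k) i => z i)).
  by rewrite prodr_const card_ord.
apply/row_matrixP => i; rewrite row0 rowE.
(* with V = e_0i the staircase moves row 0 to row k./2, where row i of the
   wanted product can be read off *)
have := key (delta_mx 0 i).
have -> : \prod_(j <- rev (enum 'I_k)) stair F s (val j)
   = \prod_(j <- rev (iota 0 k)) stair F s j.
  by rewrite -val_enum_ord -map_rev big_map.
rewrite (mulmxA _ (delta_mx 0 i)) stair_prod_iota //.
move=> /(congr1 (mulmx (delta_mx (0 : 'I_1) (inord k./2)))).
by rewrite mulmx0 !mulmxA mul_delta_mx.
Qed.

(** The spaces [W k] spanned by [B A_w] for words [w] of length at most [k]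
    start with positive dimension unless [B = 0], so they must become
    stationary at some [k < d]. *)
Lemma krylov (F : fieldType) (I : finType) (d m l : nat) (A : I -> 'M[F]_d)
  (B : 'M[F]_(m, d)) (C : 'M[F]_(d, l)) :
  (forall w : seq I, (size w < d)%N -> B *m (\prod_(i <- w) A i) *m C = 0) ->
  exists W : 'M[F]_d,
    [/\ (B <= W)%MS, forall i, (W *m A i <= W)%MS & W *m C = 0].
Proof.
move=> h.
have [->|B0] := eqVneq B 0.
  by exists 0; split=> [|i|]; rewrite ?mul0mx ?sub0mx.
pose step (W : 'M[F]_d) := (W + \sum_i <<W *m A i>>)%MS.
pose W k := iter k step <<B>>%MS.
have WC k (u : seq I) : (size u + k < d)%N -> W k *m (\prod_(i <- u) A i) *m C = 0.
  elim: k u => [|k IH] u lt.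
    apply/eqP; rewrite -mulmxA -sub_kermx genmxE sub_kermx mulmxA h //.
    by rewrite addn0 in lt.
  apply/eqP; rewrite -mulmxA -sub_kermx /= addsmx_sub sub_kermx mulmxA.
  rewrite IH ?eqxx; last by apply: leq_ltn_trans lt; rewrite leq_add2l.
  apply/sumsmx_subP => i _; rewrite genmxE sub_kermx -mulmxA (mulmxA (A i)).
  have := IH (i :: u); rewrite big_cons /= !mulmxA => -> //.
  by rewrite addSnnS.
have sub k : (W k <= W k.+1)%MS by exact: addsmxSl.
have [k lt_k st] : exists2 k, (k < d)%N & (W k.+1 <= W k)%MS.
  have [/existsP [k st]|/existsPn no] := boolP [exists k : 'I_d, (W k.+1 <= W k)%MS].
    by exists k.
  have rk k : (k <= d)%N -> (k < \rank (W k))%N.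
    elim: k => [_|k IH lt]; first by rewrite mxrank_gen lt0n mxrank_eq0.
    apply: leq_ltn_trans (IH (ltnW lt)) _; apply: rank_ltmx.
    by rewrite ltmxE sub (no (Ordinal lt)).
  by have := rk d (leqnn d); rewrite ltnNge rank_leq_col.
exists (W k); split.
- elim: (k) => [|k' IH]; first by rewrite genmxE.
  exact: submx_trans IH (sub _).
- move=> i; apply: submx_trans st; apply: submx_trans (addsmxSr _ _).
  by apply: (sumsmx_sup i); rewrite ?genmxE.
- by have := WC k [::]; rewrite big_nil mulmx1; apply.
Qed.

(** * Expansion around a point of the domain *)

(** The reshaping of [F^m (x) F^s (x) F^d] into [s]-tuples of elements of
    [F^m (x) F^d], each stored as a row.  It turns the operators [A (x) e] into
    two-sided multiplications, see [slices_mull]. *)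
Definition slices (F : fieldType) (m s d : nat) (x : 'M[F]_(m * s, d)) :
    'M[F]_(s, m * d) :=
  \matrix_i mxvec (\matrix_(u, k) x (mxtens_index (u, i)) k).

Lemma slices_sum (F : fieldType) (m s d : nat) (I : finType) (P : pred I)
  (x : I -> 'M[F]_(m * s, d)) :
  slices (\sum_(i | P i) x i) = \sum_(i | P i) slices (x i).
Proof.
apply/matrixP => i k; case/mxvec_indexP: k => u k.
rewrite summxE !mxE mxvecE mxE summxE.
by apply: eq_bigr => l _; rewrite !mxE mxvecE mxE.
Qed.

Lemma slices_lin (F : fieldType) (m s d : nat) (t : F) (x y : 'M[F]_(m * s, d)) :
  slices (x + t *: y) = slices x + t *: slices y.
Proof.
by apply/matrixP => i k; case/mxvec_indexP: k => u k; rewrite !mxE !mxvecE !mxE.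
Qed.

Lemma slices_mulr (F : fieldType) (m s d d' : nat) (x : 'M[F]_(m * s, d))
  (M : 'M_(d, d')) :
  slices (x *m M) = slices x *m lin_mulmxr M.
Proof.
apply/row_matrixP => i; rewrite row_mul !rowK mul_vec_lin /=; congr mxvec.
by apply/matrixP => u k; rewrite !mxE; apply: eq_bigr => l _; rewrite mxE.
Qed.

Lemma slices_mull (F : fieldType) (m s d : nat) (A : 'M[F]_m) (e : 'M[F]_s)
  (x : 'M[F]_(m * s, d)) :
  slices ((A *t e) *m x) = e *m slices x *m lin_mulmx A.
Proof.
apply/row_matrixP => i; rewrite row_mul rowK.
rewrite row_mul [row i e *m _]mulmx_sum_row.
under [X in _ = X *m _]eq_bigr => l _ do rewrite rowK -linearZ.
rewrite -(linear_sum mxvec) mul_vec_lin; congr mxvec.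
apply/matrixP => u k; rewrite !mxE.
rewrite (reindex (@mxtens_index m s)) /=; last first.
  by exists (@mxtens_unindex m s) => ? _; rewrite ?mxtens_indexK ?mxtens_unindexK.
pose f u' i' := A u u' * e i i' * x (mxtens_index (u', i')) k.
rewrite (eq_bigr (fun p => f p.1 p.2)); last first.
  by move=> [u' i'] _; rewrite tensmxE.
rewrite -(pair_bigA _ f) /=.
apply: eq_bigr => u' _; rewrite summxE mulr_sumr; apply: eq_bigr => i' _.
by rewrite !mxE mulrA.
Qed.

Lemma slices_surj (F : fieldType) (m s d : nat) (y : 'M[F]_(s, m * d)) :
  exists x, slices x = y.
Proof.
exists (\matrix_(k, j)
  y (mxtens_unindex k).2 (mxvec_index (mxtens_unindex k).1 j)).
apply/matrixP => i k; case/mxvec_indexP: k => u k.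
by rewrite !mxE mxvecE !mxE mxtens_indexK.
Qed.

(** For a word [w] and a set [S] of its positions, the point
    [p (x) 1 - t sum_(i in S) E_i (x) e_i] lies in the domain for generic [t],
    where [E_i] is the matrix unit of the [i]-th letter of [w] and [e_i] is a
    step of the staircase.  After reshaping by [slices] and multiplication by
    the inverse of [pencil p], its linear system is the one required by
    [staircase_extraction]. *)
Lemma words_vanish (F : fieldType) (hF : [pchar F] =i pred0) (g m s d : nat)
  (r : ratexpr F g) (L0 : 'M[F]_d) L b c (p : 'I_g -> 'M[F]_m) :
  represents r L0 L b c -> in_dom p r -> vanishes_on_dom (m * s.+1) r ->
  forall w : seq ('I_g * 'I_m * 'I_m), (size w <= s.*2.+1)%N ->
  lin_mulmxr b *m invmx (pencil_mx p L0 L) *m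
   (\prod_(l <- w) (lin_mulmx (delta_mx l.1.2 l.2) *m lin_mulmxr (L l.1.1) *m
     invmx (pencil_mx p L0 L))) *m lin_mulmxr c = 0.
Proof.
move=> rep dp van w sw.
set P := pencil_mx p L0 L; rewrite big_tnth.
apply: (staircase_extraction hF sw) => S V.
have uP : P \in unitmx by apply: pencil_mx_unit; case: (rep _ _ dp).
pose l (i : 'I_(size w)) := tnth (in_tuple w) i.
pose Y j := \sum_(i in S | (l i).1.1 == j) delta_mx (l i).1.2 (l i).2 *t stair F s i.
pose X t j := p j *t 1%:M + (- t) *: Y j.
pose Xp j := map_mx polyC (p j *t (1%:M : 'M_s.+1)) + (- 'X) *: map_mx polyC (Y j).
have XpE t : (fun j => map_mx (horner_eval t) (Xp j)) =1 X t.
  move=> j; apply/matrixP => u v; rewrite !mxE /= /horner_eval.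
  by rewrite hornerD hornerM hornerN hornerX !hornerC.
have [] := @generic_in_dom F g _ 0 Xp r.
  rewrite (eq_reval r (XpE 0)).2.
  have e0 : X 0 =1 fun j => p j *t 1%:M.
    by move=> j; rewrite /X oppr0 scale0r addr0.
  by rewrite (eq_reval r e0).2; case: (ampliation s.+1 dp).
move=> q [Q [q0 h]]; exists q.
  by apply/eqP => q_0; rewrite q_0 horner0 eqxx in q0.
move=> t /h [dX _]; rewrite (eq_reval r (XpE t)).2 in dX.
have [inj sol] := rep _ _ dX.
have [v ev] := slices_surj V.
have [x ex] := pencil_surj (v *m b) inj.
exists (slices x); split; last first.
  by rewrite -slices_mulr (sol _ _ ex) (van _ dX) mul0mx; apply/matrixP => i j;
     case/mxvec_indexP: j => u k; rewrite !mxE mxvecE !mxE.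
apply: (can_inj (mulmxK uP)).
rewrite -ev -[RHS]mulmxA mulmxKV // -slices_mulr -ex.
have -> : (slices x - t *: (\sum_(i in S) stair F s i *m slices x *m
   (lin_mulmx (delta_mx (l i).1.2 (l i).2) *m lin_mulmxr (L (l i).1.1) *m invmx P))) *m P
  = slices x *m P - t *: \sum_(i in S) stair F s i *m slices x *m
   lin_mulmx (delta_mx (l i).1.2 (l i).2) *m lin_mulmxr (L (l i).1.1).
  rewrite mulmxBl -scalemxAl mulmx_suml; congr (_ - _ *: _).
  by apply: eq_bigr => i _; rewrite !mulmxA mulmxKV.
have -> : pencil (X t) L0 L x = pencil (fun j => p j *t 1%:M) L0 L x +
  (- t) *: \sum_(i in S) (delta_mx (l i).1.2 (l i).2 *t stair F s i) *m x *m L (l i).1.1.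
  rewrite /pencil -addrA; congr (_ + _).
  rewrite (partition_big (fun i => (l i).1.1) xpredT) //= scaler_sumr -big_split /=.
  apply: eq_bigr => j _; rewrite /X !mulmxDl -!scalemxAl; congr (_ + _ *: _).
  by rewrite /Y !mulmx_suml; apply: eq_bigr => i /andP[_ /eqP ->].
rewrite slices_lin scaleNr slices_sum; congr (_ - _ *: _); last first.
  by apply: eq_bigr => i _; rewrite slices_mulr slices_mull.
rewrite /pencil -[X in _ = slices (_ + X)]scale1r slices_lin scale1r slices_sum.
rewrite slices_mulr mulmxDr mulmx_sumr; congr (_ + _).
by apply: eq_bigr => j _; rewrite slices_mulr slices_mull mul1mx mulmxA.
Qed.

(** The coefficients [M0] and [M j] of the pencil of [1 (x) a] normalized by [P]
    are combinations of the identity and of the operators [A_l], so they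
    preserve [W] and [pencil_inj_sub] applies.  The maps [K u], tensoring with a vector
    [u] of [F^m], and [S u], taking the [u]-th coordinate in [F^m], intertwine
    the pencils of [a] and [1 (x) a]: the first transports solutions and the
    second transports injectivity. *)
Lemma represented_vanish (F : fieldType) (g m d : nat) (hm : (0 < m)%N)
  (r : ratexpr F g) (L0 : 'M[F]_d) L b c (p : 'I_g -> 'M[F]_m)
  (W : 'M[F]_(m * d)) :
  represents r L0 L b c -> in_dom p r ->
  let P := pencil_mx p L0 L in
  (lin_mulmxr b *m invmx P <= W)%MS ->
  (forall l : 'I_g * 'I_m * 'I_m,
    (W *m (lin_mulmx (delta_mx l.1.2 l.2) *m lin_mulmxr (L l.1.1) *m invmx P)
      <= W)%MS) ->
  W *m lin_mulmxr c = 0 ->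
  forall n, vanishes_on_dom n r.
Proof.
move=> rep dp P sB sA WC n a da.
have uP : P \in unitmx by apply: pencil_mx_unit; case: (rep _ _ dp).
have [inj sol] := rep _ _ da.
pose M0 := lin_mulmxr L0 *m invmx P; pose M j := lin_mulmxr (L j) *m invmx P.
have lin_sum_delta (A : 'M[F]_m) (N : 'M[F]_(m * d)) : (forall u v,
    (W *m (lin_mulmx (delta_mx u v) *m N) <= W)%MS) ->
    (W *m (lin_mulmx A *m N) <= W)%MS.
  move=> h; rewrite {1}[A]matrix_sum_delta linear_sum mulmx_suml mulmx_sumr.
  apply: summx_sub => u _; rewrite linear_sum mulmx_suml mulmx_sumr.
  apply: summx_sub => v _; rewrite linearZ -scalemxAl -scalemxAr.
  exact: scalemx_sub (h u v).
have sA' j A : (W *m (lin_mulmx A *m M j) <= W)%MS.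
  by apply: lin_sum_delta => u v; have := sA (j, u, v); rewrite /M !mulmxA.
have sM j : (W *m M j <= W)%MS.
  have := sA' j 1%:M; rewrite (_ : lin_mulmx 1%:M = 1%:M) ?mul1mx //.
  apply/row_matrixP => i; rewrite rowE mul_rV_lin /= mul1mx vec_mxK.
  by rewrite rowE mulmx1.
(* normalized by P, the pencil at p is the identity, so M0 is 1 minus the
   operators of the letters weighted by the entries of p *)
have sM0 : (W *m M0 <= W)%MS.
  have -> : M0 = 1%:M - \sum_j lin_mulmx (p j) *m M j.
    apply/eqP; rewrite eq_sym subr_eq -(mulmxV uP) {1}/P /pencil_mx mulmxDl.
    rewrite mulmx_suml; apply/eqP; congr (_ + _).
    by apply: eq_bigr => j _; rewrite mulmxA.
  rewrite mulmxBr mulmx1 addmx_sub // eqmx_opp mulmx_sumr.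
  by apply: summx_sub => j _; apply: sA'.
pose K d' (u : 'cV[F]_m) : 'M[F]_(d', m * d') := lin1_mx (mxvec \o mulmx u).
have KE d' u (y : 'rV_d') : y *m K d' u = mxvec (u *m y) by rewrite mul_rV_lin1.
have KM d1 d2 u (A : 'M_(d1, d2)) : A *m K _ u = K _ u *m lin_mulmxr A.
  apply/row_matrixP => i; rewrite !row_mul KE [row i (K _ _)]rowE KE mul_vec_lin /=.
  by rewrite -mulmxA -rowE.
pose S u : 'M[F]_(m * d, d) := lin1_mx (row u \o vec_mx).
have SE u (y : 'M_(m, d)) : mxvec y *m S u = row u y by rewrite mul_rV_lin1 /= mxvecK.
have SM u (A : 'M_d) : lin_mulmxr A *m S u = S u *m A.
  apply/row_matrixP => i; rewrite !rowE !mulmxA -[delta_mx _ _]vec_mxK.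
  by rewrite mul_vec_lin /= !SE row_mul.
have PM (x : 'M_(n, m * d)) : pencil a M0 M x
    = pencil a (lin_mulmxr L0) (fun j => lin_mulmxr (L j)) x *m invmx P.
  rewrite /pencil mulmxDl mulmx_suml mulmxA; congr (_ + _).
  by apply: eq_bigr => j _; rewrite !mulmxA.
have injM (x : 'M_(n, m * d)) : pencil a M0 M x = 0 -> x = 0.
  rewrite PM => /(congr1 (mulmx^~ P)); rewrite mul0mx mulmxKV // => x0.
  apply/row_matrixP => i; rewrite row0 -[row i x]vec_mxK.
  suff -> : vec_mx (row i x) = 0 by rewrite linear0.
  apply/row_matrixP => u; rewrite row0 -SE vec_mxK -row_mul.
  rewrite [x *m S u]inj ?row0 //.
  by rewrite -(pencil_intertwine _ _ (SM u L0) (fun j => SM u (L j))) x0 mul0mx.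
pose u : 'cV[F]_m := delta_mx (Ordinal hm) 0.
have u1 : (delta_mx 0 (Ordinal hm) : 'rV_m) *m u = 1%:M.
  by rewrite mul_delta_mx; apply/matrixP => i j; rewrite !ord1 !mxE.
suff z (v : 'cV_n) : reval a r *m v = 0.
  apply/matrixP => i j; have /colP/(_ i) := z (delta_mx j 0).
  by rewrite -colE !mxE.
have [x ex] := pencil_surj (v *m b) inj.
rewrite -(sol _ _ ex).
have : (x *m K d u <= W)%MS.
  apply: (pencil_inj_sub injM sM0 sM); rewrite PM.
  rewrite -(pencil_intertwine _ _ (KM _ _ u L0) (fun j => KM _ _ u (L j))) ex.
  by rewrite -[v *m b *m _]mulmxA KM !mulmxA -mulmxA mulmx_sub.
case/submxP => D eD.
have xcK : x *m c *m K 1 u = 0 by rewrite -mulmxA KM mulmxA eD -mulmxA WC mulmx0.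
apply/row_matrixP => i; rewrite row0.
have : row i (x *m c *m K 1 u) = 0 by rewrite xcK row0.
rewrite row_mul KE => /(congr1 vec_mx); rewrite mxvecK linear0.
move=> /(congr1 (mulmx (delta_mx (0 : 'I_1) (Ordinal hm)))).
by rewrite mulmx0 mulmxA u1 mul1mx.
Qed.

Theorem corollary6p2 (F : fieldType) (hF : [pchar F] =i pred0) (g : nat)
  (r : ratexpr F g) (m : nat) (hm : (0 < m)%N) (hdom : dom_nonempty m r) :
  rational_identity r <->
  vanishes_on_dom (m * uphalf (m * kappa r))%N r.
Proof.
have k0 : (0 < kappa r)%N by elim: (r) => //= r1 h1 r2 h2; rewrite addn_gt0 h1.
have mk0 : (0 < m * kappa r)%N by rewrite muln_gt0 hm.
case Es : (uphalf (m * kappa r)) => [|s]; first by lia.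
split=> [[_ van]|van]; first by apply: van; rewrite muln_gt0 hm.
split; first by exists m.
have [p dp] := hdom.
have [L0 [L [b [c rep]]]] := linearization r.
pose P := pencil_mx p L0 L.
pose A (l : 'I_g * 'I_m * 'I_m) :=
  lin_mulmx (delta_mx l.1.2 l.2) *m lin_mulmxr (L l.1.1) *m invmx P.
(* words of length < m * kappa r <= 2 s + 2 fit in a staircase of size s + 1 *)
have [w lt_w|W [sB sA WC]] := @krylov F _ _ _ _ A (lin_mulmxr b *m invmx P)
    (lin_mulmxr c).
  apply: (words_vanish hF rep dp van); rewrite -ltnS -doubleS.
  by apply: leq_trans lt_w _; rewrite -leq_uphalf_double Es.
move=> n _; exact: (represented_vanish hm rep dp sB sA WC).
Qed.
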